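(* Let $n\to\infty$. Fix integers $k\ge1$ and $2\le d_1<\dots<d_k$ and reals $\delta_1,\dots,\delta_k\in(0,1)$. For each $i$, each $d_i$-element subset of $[n]$ is a hyperedge of degree $d_i$ independently with probability $p_i=n^{1-d_i+\delta_i+o(1)}$, all hyperedges across all degrees being independent, and let $\psi$ be the projected graph on $[n]$ ($\{u,v\}$ is an edge of $\psi$ iff some hyperedge contains both $u$ and $v$). Fix (independently of $n$) a nonempty set $E$ of edges, and let $V$ be the set of vertices spanned by $E$. Define $\mathbf{\Delta}=(\mathbf{\Delta}_2,\dots,\mathbf{\Delta}_{|V|})$ by $\mathbf{\Delta}_\ell=\max_{r:\,d_r\ge\ell}\delta_r$ for $\ell\le d_k$ and $\mathbf{\Delta}_\ell=-\infty$ for $\ell>d_k$. Then $$\mathbb{P}(E\subset\psi)=n^{g(E,\mathbf{\Delta})+o(1)}.$$ Moreover, for any particular cover $\mathcal{U}$ of $E$, $$\mathbb{P}(E\subset\psi)\ge(1-o(1))\prod_{u\in\mathcal{U}}\sum_{i:\,d_i\ge|u|}\binom{n-|V|}{d_i-|u|}p_i,$$ and $$\mathbb{P}(E\subset\psi)\le\sum_{\mathcal{U}}\prod_{u\in\mathcal{U}}\sum_{i:\,d_i\ge|u|}\binom{n-|V|}{d_i-|u|}p_i,$$ where the sum is over all covers $\mathcal{U}$ of $E$.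
   Context: A cover of an edge set $E$ spanning vertex set $V$ is a family $\mathcal{U}\subset 2^V$ such that (i) every $u\in\mathcal{U}$ has $|u|\ge2$ and $E\not\subset\bigcup_{u'\in\mathcal{U}\setminus\{u\}}\binom{u'}{2}$, and (ii) $E\subset\bigcup_{u\in\mathcal{U}}\binom{u}{2}$ (here $\binom{u}{2}$ is the set of 2-element subsets of $u$). For a vector $\mathbf{\Delta}=(\mathbf{\Delta}_2,\dots,\mathbf{\Delta}_{|V|})$ with entries $<1$ (entries $-\infty$ allowed), $g(E,\mathbf{\Delta})=\max_{\mathcal{U}}\sum_{u\in\mathcal{U}}\left(1+\mathbf{\Delta}_{|u|}-|u|\right)$, the maximum over all covers $\mathcal{U}$ of $E$. The notation $n^{a+o(1)}$ denotes $n^{a+\epsilon_n}$ with $\epsilon_n\to0$; $o(1)$ denotes a quantity tending to $0$ as $n\to\infty$. *)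

(* Defs.v *)
From HB Require Import structures.
From mathcomp Require Import all_boot all_order all_algebra.
From mathcomp Require Import all_classical all_reals all_analysis.

Set Implicit Arguments.
Unset Strict Implicit.
Unset Printing Implicit Defensive.

Import Order.TTheory GRing.Theory Num.Theory.
Import numFieldNormedType.Exports.

Local Open Scope ring_scope.

Section Covers.
Variable T : finType.
Implicit Types (u : {set T}) (E U : {set {set T}}).

Definition pairs u : {set {set T}} :=
  [set e : {set T} | (e \subset u) && (#|e| == 2)%N]%SET.

Definition span E : {set T} := (\bigcup_(e in E) e)%SET.

Definition is_cover E U : bool :=
  [&& U \subset powerset (span E),
      [forall u in U, (2 <= #|u|)%N
         && ~~ (E \subset (\bigcup_(u' in (U :\ u)%SET) pairs u')%SET)]
    & E \subset (\bigcup_(u in U) pairs u)%SET].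

(* The set of covers is nonempty whenever E consists of pairs (E covers
   itself), so the default value -oo of the big maximum is then harmless. *)
Definition cover_exponent (R : realType) E (Delta : nat -> \bar R) : \bar R :=
  (\big[maxe/-oo]_(U : {set {set T}} | is_cover E U)
     \sum_(u in U) (1 + Delta #|u| - (#|u|%:R)%:E))%E.

End Covers.

Section RandomHypergraph.
Variables (R : realType) (k : nat) (d : 'I_k -> nat).

Definition slots (n : nat) : {set 'I_k * {set 'I_n}} :=
  [set x : 'I_k * {set 'I_n} | #|x.2| == d x.1]%SET.

(* Product law: a hypergraph is a subset H of [slots n], where (i, h) \in H
   means that the d_i-set h is a hyperedge; the slots are independent, and
   (i, h) is present with probability q i. *)
Definition hyperPr (n : nat) (q : 'I_k -> R)
    (A : pred {set 'I_k * {set 'I_n}}) : R :=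
  \sum_(H in powerset (slots n) | A H)
    \prod_(x in slots n) (if x \in H then q x.1 else 1 - q x.1).

Definition projected (n : nat) (H : {set 'I_k * {set 'I_n}}) :
    {set {set 'I_n}} :=
  [set e : {set 'I_n} | (#|e| == 2)%N && [exists x in H, e \subset x.2]]%SET.

(* The vertices of 'I_n with the same labels as those of w. For m <= n this is
   the image of w under the inclusion of 'I_m in 'I_n; it lets a set of edges
   that does not depend on n be read in every vertex set 'I_n. *)
Definition same_labels (m n : nat) (w : {set 'I_m}) : {set 'I_n} :=
  [set v : 'I_n | [exists x in w, nat_of_ord x == nat_of_ord v]]%SET.

Definition Pr_sub_projected (p : nat -> 'I_k -> R) (m : nat)
    (E : {set {set 'I_m}}) (n : nat) : R :=
  hyperPr (p n) (fun H : {set 'I_k * {set 'I_n}} =>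
    [forall e in E, same_labels n e \in projected H]).

Definition cover_prod (p : nat -> 'I_k -> R) (m : nat)
    (E U : {set {set 'I_m}}) (n : nat) : R :=
  \prod_(u in U)
    \sum_(i < k | (#|u| <= d i)%N)
      'C(n - #|span E|, d i - #|u|)%:R * p n i.

(* For l > d_k the range is empty, which gives the value -oo. *)
Definition max_delta (delta : 'I_k -> R) (l : nat) : \bar R :=
  (\big[maxe/-oo]_(r < k | (l <= d r)%N) (delta r)%:E)%E.

End RandomHypergraph.

(* u_n = n^(a + o(1)) as n tends to infinity. *)
Definition npow_o1 (R : realType) (u : nat -> R) (a : R) : Prop :=
  exists2 eps : nat -> R, (eps @ \oo --> (0 : R))%classic &
    (\forall n \near \oo, u n = n%:R `^ (a + eps n))%classic.

(* Main.v *)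
Require Import Defs.
From HB Require Import structures.
From mathcomp Require Import all_boot all_order all_algebra.
From mathcomp Require Import all_classical all_reals all_analysis.
From mathcomp Require Import lra zify.

Import Order.TTheory GRing.Theory Num.Theory.
Import numFieldNormedType.Exports.

Local Open Scope ring_scope.

(* Let V be the vertex set spanned by E. A hyperedge h matters only through its
   trace on V, the intersection of h and V. E is contained in the projected
   graph iff the traces that occur contain some cover U (a minimal subfamily of
   the traces which still covers E). Hyperedges with distinct traces are
   distinct, so the events "the trace u occurs", u in U, are independent, and
   with s_u the expected number of hyperedges of trace u,
   s_u / (1 + s_u) <= P(u occurs) <= s_u. The union bound over covers gives the
   upper bound, a single cover the lower bound, as every s_u tends to 0. The
   upper bound is thus sharp up to a constant factor, and its exponent is
   computed term by term, a sum of powers of n having the largest exponent. *)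

(** * Random subsets *)

(** Distributivity: [H] records from which factors [f] is picked. It computes total weights and
    drives the inclusion-exclusion below. *)
Lemma sum_powerset_prod (R : realDomainType) (T : finType) (S : {set T})
    (f g : T -> R) :
  \sum_(H in powerset S) \prod_(x in S) (if x \in H then f x else g x) =
  \prod_(x in S) (f x + g x).
Proof.
rewrite [RHS]big_mkcond /=.
(* Extending [f] by 0 and [g] by 1 off [S] makes the product range over all of [T]; sets [H] not
   inside [S] then contribute 0. *)
rewrite (eq_bigr (fun x => (if x \in S then f x else 0) +
                           (if x \in S then g x else 1))); last first.
  by move=> x _; case: ifP; rewrite ?add0r.
rewrite bigA_distr [RHS](bigID (fun H => H \in powerset S)) /=.
rewrite [X in _ = _ + X]big1 ?addr0 => [|H].
  apply: eq_bigr => H; rewrite powersetE => /fintype.subsetP HS.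
  rewrite big_mkcond; apply: eq_bigr => x _.
  by have := HS x; case: (x \in H); case: (x \in S) => // /(_ isT).
rewrite powersetE => /fintype.subsetPn[x xH xS].
by rewrite (bigD1 x) //= xH (negPf xS) mul0r.
Qed.

Section RandomSubset.
Variables (R : realDomainType) (T : finType).
Implicit Types (S H : {set T}) (q : T -> R).

Definition subset_weight S q H : R :=
  \prod_(x in S) (if x \in H then q x else 1 - q x).

Lemma subset_weight_ge0 S q H : (forall x, 0 <= q x <= 1) ->
  0 <= subset_weight S q H.
Proof.
move=> q01; apply: prodr_ge0 => x _.
by case: ifP => _; have /andP[] := q01 x; rewrite ?subr_ge0.
Qed.

Section Coloured.
Variables (I : finType) (c : T -> I).

Definition hits (U : {set I}) H : bool :=
  [forall u in U, [exists x in H, c x == u]].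

(** A colour is hit iff it is not avoided. Each factor has the form [- a + 1] so that
    [sum_powerset_prod] can expand the product. *)
Lemma hits_indicatorE U H :
  (hits U H)%:R = \prod_(u in U) (- [forall x in H, c x != u]%:R + 1) :> R.
Proof.
case: (boolP (hits U H)) => [/forall_inP hU|/forall_inPn[u uU nu]].
  rewrite big1 // => u /hU/exists_inP[x xH cx].
  rewrite (_ : [forall _ in H, _] = false) ?oppr0 ?add0r //.
  by apply/negbTE/forall_inPn; exists x; rewrite ?negbK.
rewrite (bigD1 u) //= (_ : [forall _ in H, _] = true) ?addNr ?mul0r //.
by apply/forall_inP => x xH; apply: contraNN nu => cx; apply/exists_inP; exists x.
Qed.

Lemma subset_weight_avoid S q (J : {set I}) :
  \sum_(H in powerset S)
    subset_weight S q H * \prod_(u in J) [forall x in H, c x != u]%:R =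
  \prod_(u in J) \prod_(x in S | c x == u) (1 - q x).
Proof.
rewrite (exchange_big_dep (fun x => (x \in S) && (c x \in J))) /=; last first.
  by move=> u x uJ /andP[-> /eqP->].
(* Avoiding [J] forces every element with colour in [J] to be absent, which replaces its weight of
   presence by 0; any other element contributes [q x + (1 - q x) = 1]. *)
transitivity (\prod_(x in S) ((if c x \in J then 0 else q x) + (1 - q x))).
  rewrite -sum_powerset_prod; apply: eq_bigr => H; rewrite powersetE => /fintype.subsetP HS.
  rewrite /subset_weight.
  case: (boolP [exists x in H, c x \in J]) => [/exists_inP[x xH xJ]|].
    rewrite [RHS](bigD1 x) ?HS //= xH xJ mul0r.
    rewrite [X in _ * X](bigD1 (c x)) //= (_ : [forall _ in H, _] = false).
      by rewrite mul0r mulr0.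
    by apply/negbTE/forall_inPn; exists x; rewrite ?negbK.
  move=> /exists_inPn nJ; rewrite [X in _ * X]big1 ?mulr1.
    by apply: eq_bigr => x _; case: ifP => // /nJ/negPf ->.
  move=> u uJ; rewrite (_ : [forall _ in H, _] = true) //.
  by apply/forall_inP => x /nJ; apply: contra => /eqP->.
rewrite big_mkcondr; apply: eq_bigr => x xS; case: ifP => cxJ.
  rewrite add0r (big_pred1 (c x)) // => u /=; rewrite xS eq_sym /=.
  by case: eqP => [->|]; rewrite ?cxJ ?andbF.
by rewrite addrC subrK.
Qed.

(* Independence of the colour classes, by inclusion-exclusion over the set J of
   avoided colours. *)
Lemma sum_subset_weight_hits S q U :
  \sum_(H in powerset S | hits U H) subset_weight S q H =
  \prod_(u in U) (1 - \prod_(x in S | c x == u) (1 - q x)).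
Proof.
rewrite big_mkcondr /=.
transitivity (\sum_(H in powerset S) \sum_(J in powerset U)
   subset_weight S q H *
   \prod_(u in U) (if u \in J then - [forall x in H, c x != u]%:R else 1)).
  apply: eq_bigr => H _; rewrite -mulr_sumr sum_powerset_prod -hits_indicatorE.
  by case: ifP; rewrite ?mulr1 ?mulr0.
rewrite exchange_big /=.
(* The right-hand side expands over the sets [J] as well, and the two sums agree term by term. *)
under [RHS]eq_bigr => u _ do rewrite addrC.
rewrite -sum_powerset_prod; apply: eq_bigr => J; rewrite powersetE => JU.
have split_sign (n : I -> R) : \prod_(u in U) (if u \in J then - n u else 1) =
    (-1) ^+ #|J| * \prod_(u in J) n u.
  rewrite -big_mkcondr /= -prodrN; apply: eq_bigl => u.
  by rewrite andbC; case: (boolP (u \in J)) => // /(fintype.subsetP JU) ->.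
rewrite split_sign -subset_weight_avoid mulr_sumr; apply: eq_bigr => H _.
by rewrite split_sign mulrCA.
Qed.

End Coloured.
End RandomSubset.

(** * Probability that a class of independent elements is hit *)

Section MissProbability.
Variables (R : realFieldType) (T : finType) (P : pred T) (q : T -> R).
Hypothesis q01 : forall x, 0 <= q x <= 1.

(** One induction carries all four bounds, since they feed each other. With [s] the sum so far and
    [x] the new probability, it rests on [(1 - x)(1 - s) >= 1 - x - s] and
    [(1 - x)(1 + x + s) <= 1 + s]. *)
Lemma prod_onem_bounds :
  [/\ 0 <= \prod_(x | P x) (1 - q x) <= 1, 0 <= \sum_(x | P x) q x,
      1 - \sum_(x | P x) q x <= \prod_(x | P x) (1 - q x) &
      \prod_(x | P x) (1 - q x) * (1 + \sum_(x | P x) q x) <= 1].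
Proof.
apply: (big_rec2 (fun a s => [/\ 0 <= a <= 1, 0 <= s, 1 - s <= a &
   a * (1 + s) <= 1])); first by rewrite subr0 addr0 mulr1 lexx ler01.
move=> x a s _ [/andP[a0 a1] s0 sa as1]; have /andP[q0 q1] := q01 x.
by split; [apply/andP; split; nra|nra|nra|nra].
Qed.

Lemma hit_prob_le : 1 - \prod_(x | P x) (1 - q x) <= \sum_(x | P x) q x.
Proof. by have [_ _ h _] := prod_onem_bounds; lra. Qed.

Lemma hit_prob_ge0 : 0 <= 1 - \prod_(x | P x) (1 - q x).
Proof. by have [/andP[_ h] _ _ _] := prod_onem_bounds; lra. Qed.

(** A rearrangement of the last bound of [prod_onem_bounds]. The inverse stands apart because these
    factors later form the [1 - o(1)]. *)
Lemma hit_prob_ge :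
  (1 + \sum_(x | P x) q x)^-1 * \sum_(x | P x) q x <=
  1 - \prod_(x | P x) (1 - q x).
Proof.
have [_ s0 _ h] := prod_onem_bounds.
by rewrite mulrC ler_pdivrMr ?ltr_wpDr //; nra.
Qed.

End MissProbability.

(** * Counting the hyperedges with a given trace *)

Lemma card_trace (T : finType) (V u : {set T}) (D : nat) : u \subset V ->
  #|[set h : {set T} | (#|h| == D) && (h :&: V == u)]%SET| =
  (if #|u| <= D then 'C(#|~: V|, D - #|u|) else 0)%N.
Proof.
move=> uV; case: leqP => uD; last first.
  apply/eqP; rewrite cards_eq0 -finset.subset0; apply/fintype.subsetP => h; rewrite !inE.
  case/andP => /eqP hD /eqP hV; move: uD; rewrite ltnNge -hD => /negP[].
  by rewrite subset_leq_card // -hV finset.subsetIl.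
rewrite -cards_draws.
have dis (A : {set T}) : A \subset ~: V -> A :&: V = finset.set0.
  by move=> AV; apply/eqP; rewrite finset.setI_eq0 finset.disjoints_subset.
have trU (A : {set T}) : A \subset ~: V -> (A :|: u) :&: V = u.
  by move=> AV; rewrite finset.setIUl (dis A AV) finset.set0U; apply/finset.setIidPl.
(* Sets of trace [u] correspond to subsets of the complement of [V] by adjoining [u]; the inverse
   removes [V]. *)
rewrite -[RHS](card_in_imset (f := fun A => A :|: u)) => [|A B].
  apply: eq_card => h; rewrite !inE; apply/idP/imsetP => [/andP[/eqP hD /eqP hV]|].
    exists (h :\: V); last by rewrite -hV finset.setUC finset.setID.
    rewrite !inE finset.setDE finset.subsetIr /= -finset.setDE cardsD hV hD eqxx //.
  case=> A; rewrite !inE => /andP[AV /eqP cA] ->.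
  rewrite trU // eqxx andbT cardsU cA.
  rewrite (_ : A :&: u = finset.set0) ?cards0 ?subn0 ?subnK //.
  by apply/eqP; rewrite -finset.subset0 -(dis A AV) finset.setIS.
rewrite !inE => /andP[AV _] /andP[BV _] eAB.
have dA (C : {set T}) : C \subset ~: V -> (C :|: u) :\: V = C.
  move=> CV; rewrite finset.setDUl (_ : u :\: V = finset.set0) ?finset.setU0.
    by apply/finset.setDidPl; rewrite finset.disjoints_subset.
  by apply/eqP; rewrite finset.setD_eq0.
by rewrite -(dA A AV) eAB dA.
Qed.

Section TraceSum.
Variables (R : realType) (k : nat) (d : 'I_k -> nat) (n : nat).

(** Grouping the slots by degree and counting each group with [card_trace] produces the inner sum of
    [cover_prod]. *)
Lemma sum_slots_trace (q : 'I_k -> R) (V u : {set 'I_n}) : u \subset V ->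
  \sum_(x in slots d n | x.2 :&: V == u) q x.1 =
  \sum_(i < k | (#|u| <= d i)%N) 'C(n - #|V|, d i - #|u|)%:R * q i.
Proof.
move=> uV.
rewrite (eq_bigl (fun x : 'I_k * {set 'I_n} =>
    predT x.1 && ((#|x.2| == d x.1) && (x.2 :&: V == u)))); last first.
  by move=> x; rewrite inE.
rewrite -(pair_big_dep predT (fun i (h : {set 'I_n}) => (#|h| == d i) && (h :&: V == u))
  (fun i _ => q i)) /= [RHS]big_mkcond.
apply: eq_bigr => i _; rewrite sumr_const.
have := card_trace _ V u (d i) uV; rewrite cardsE /= => ->.
rewrite [#|~: V|]cardsCs finset.setCK card_ord.
by case: ifP => _; rewrite ?mulr0n // mulr_natl.
Qed.

End TraceSum.

(** * Covers and traces *)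

Section SameLabels.
Variables (m n : nat) (mn : (m <= n)%N).
Implicit Types (u w : {set 'I_m}).

Lemma same_labelsE w : same_labels n w = widen_ord mn @: w.
Proof.
apply/setP => v; rewrite inE; apply/exists_inP/imsetP => [[x xw /eqP xv]|].
  by exists x => //; apply: val_inj.
by case=> x xw ->; exists x.
Qed.

Lemma widen_ord_inj : injective (widen_ord mn).
Proof. by move=> x y /(congr1 val) /= /val_inj. Qed.

Lemma same_labels_inj : injective (@same_labels m n).
Proof.
by move=> u w; rewrite !same_labelsE => /(imset_inj widen_ord_inj).
Qed.

Lemma card_same_labels w : #|same_labels n w| = #|w|.
Proof. by rewrite same_labelsE card_imset //; exact: widen_ord_inj. Qed.

Lemma same_labelsS u w :
  (same_labels n u \subset same_labels n w) = (u \subset w).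
Proof.
rewrite !same_labelsE; apply/idP/idP => [/fintype.subsetP s|]; last exact: imsetS.
apply/fintype.subsetP => x xu.
by have := s _ (imset_f _ xu); rewrite mem_imset //; exact: widen_ord_inj.
Qed.

Lemma sub_same_labels (w : {set 'I_m}) (h : {set 'I_n}) :
  h \subset same_labels n w -> exists2 u : {set 'I_m}, u \subset w & h = same_labels n u.
Proof.
rewrite same_labelsE => /fintype.subsetP hw.
exists [set x in w | widen_ord mn x \in h]%SET.
  by apply/fintype.subsetP => x; rewrite inE => /andP[].
rewrite same_labelsE; apply/setP => v; apply/idP/imsetP => [vh|].
  by have /imsetP[x xw xv] := hw _ vh; exists x; rewrite // inE xw -xv.
by case=> x; rewrite inE => /andP[_ xh] ->.
Qed.

End SameLabels.

Section CoverEvents.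
Variables (k m n : nat) (mn : (m <= n)%N) (E : {set {set 'I_m}}).
Hypothesis E_edges : forall e : {set 'I_m}, e \in E -> #|e| = 2%N.
Implicit Types (U : {set {set 'I_m}}) (H : {set 'I_k * {set 'I_n}}).

Definition trace (x : 'I_k * {set 'I_n}) : {set 'I_n} :=
  x.2 :&: same_labels n (Defs.span E).

Definition cover_hits U H : bool :=
  hits _ _ trace [set same_labels n u | u in U]%SET H.

(** Each edge lies in some [u] of the cover, and a hyperedge with trace [u] contains [u]. *)
Lemma cover_hits_sub_projected U H : is_cover E U -> cover_hits U H ->
  [forall e in E, same_labels n e \in projected H].
Proof.
case/and3P => _ _ /fintype.subsetP EU /forall_inP hU; apply/forall_inP => e eE.
have /bigcupP[u uU] := EU _ eE; rewrite inE => /andP[eu _].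
rewrite inE card_same_labels // E_edges //=.
have /exists_inP[x xH /eqP xu] := hU _ (imset_f _ uU).
apply/exists_inP; exists x => //.
apply: (@fintype.subset_trans _ _ (mem (same_labels n u))).
  by rewrite same_labelsS.
by rewrite -xu finset.subsetIl.
Qed.

Lemma edge_sub_span e : e \in E -> e \subset Defs.span E.
Proof. by move=> eE; apply: finset.bigcup_sup. Qed.

Lemma sub_projected_cover_hits H :
  [forall e in E, same_labels n e \in projected H] ->
  exists2 U, is_cover E U & cover_hits U H.
Proof.
move=> /forall_inP EH.
(* The traces that occur, read back in ['I_m]. Those with fewer than two vertices are dropped, as
   they contain no edge. *)
pose W := [set u : {set 'I_m} | [&& u \subset Defs.span E, (2 <= #|u|)%N &
  [exists x in H, trace x == same_labels n u]]]%SET.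
pose P U := E \subset (\bigcup_(u in U) pairs u)%SET.
have PW : P W.
  apply/fintype.subsetP => e eE.
  have := EH _ eE; rewrite inE => /andP[_ /exists_inP[x xH ex]].
  have [|u uV xu] := @sub_same_labels _ _ mn (Defs.span E) (trace x).
    exact: finset.subsetIr.
  have eu : e \subset u.
    rewrite -(same_labelsS _ _ mn) -xu finset.subsetI ex.
    by rewrite same_labelsS // edge_sub_span.
  apply/bigcupP; exists u; last by rewrite inE eu E_edges.
  rewrite inE uV -(E_edges _ eE) subset_leq_card //=.
  by apply/exists_inP; exists x => //; apply/eqP.
(* Minimality supplies the irredundancy of a cover: were [U] without [u] still covering, it would
   equal [U]. *)
have [U /minsetP[PU minU] /fintype.subsetP UW] := minset_exists PW.
exists U.
  apply/and3P; split => //.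
    apply/fintype.subsetP => u /UW; rewrite inE powersetE.
    by case/and3P.
  apply/forall_inP => u uU; have := UW _ uU; rewrite inE => /and3P[_ -> _] /=.
  apply/negP => Pu; have /setP/(_ u) := minU _ Pu (finset.subD1set _ _).
  by rewrite !inE eqxx uU.
apply/forall_inP => _ /imsetP[u uU ->].
by have := UW _ uU; rewrite inE => /and3P[].
Qed.

End CoverEvents.

(** The expected number of hyperedges with a given trace of size [l] on a vertex set of size [s];
    only the sizes matter. *)
Definition trace_sum {R : realType} {k : nat} (d : 'I_k -> nat)
    (p : nat -> 'I_k -> R) (s l n : nat) : R :=
  \sum_(i < k | (l <= d i)%N) 'C(n - s, d i - l)%:R * p n i.

(** * Bounds on the probability in terms of covers *)

Section Bounds.
Variables (R : realType) (k : nat) (d : 'I_k -> nat) (p : nat -> 'I_k -> R).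
Variables (m n : nat) (mn : (m <= n)%N) (E : {set {set 'I_m}}).
Hypothesis E_edges : forall e : {set 'I_m}, e \in E -> #|e| = 2%N.
Hypothesis p01 : forall (n : nat) (i : 'I_k), 0 <= p n i <= 1.

Lemma trace_sum_ge0 s l : 0 <= trace_sum d p s l n.
Proof.
apply: sumr_ge0 => i _; apply: mulr_ge0; first exact: ler0n.
by have /andP[] := p01 n i.
Qed.

Let q (x : 'I_k * {set 'I_n}) : R := p n x.1.
Let q01 x : 0 <= q x <= 1. Proof. exact: p01. Qed.

Lemma hyperPr_cover_hits U :
  hyperPr d (p n) (cover_hits k m n E U) =
  \prod_(u in U) (1 - \prod_(x in slots d n |
    trace k m n E x == same_labels n u) (1 - q x)).
Proof.
transitivity (\sum_(H in powerset (slots d n) | cover_hits k m n E U H)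
   subset_weight _ _ (slots d n) q H); first by [].
rewrite sum_subset_weight_hits big_imset //= => u w _ _.
exact: same_labels_inj.
Qed.

Lemma sum_trace_slots (U : {set {set 'I_m}}) u : is_cover E U -> u \in U ->
  \sum_(x in slots d n | trace k m n E x == same_labels n u) q x =
  trace_sum d p #|Defs.span E| #|u| n.
Proof.
case/and3P => /fintype.subsetP UV _ _ /UV; rewrite powersetE => uV.
rewrite sum_slots_trace ?same_labelsS // !card_same_labels //.
Qed.

Lemma Pr_sub_projected_le_sum_cover :
  Pr_sub_projected d p E n <=
  \sum_(U : {set {set 'I_m}} | is_cover E U) cover_prod d p E U n.
Proof.
apply: (@le_trans _ _ (\sum_(U : {set {set 'I_m}} | is_cover E U)
    hyperPr d (p n) (cover_hits k m n E U))).
  (* The union bound, one hypergraph at a time: the weight of [H] counts at most once on the left,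
     and on the right once for each cover that [H] hits. *)
  rewrite /Pr_sub_projected /hyperPr (exchange_big_dep (fun H =>
    H \in powerset (slots d n))) /=; last by move=> ? ? _ /andP[].
  rewrite big_mkcondr /=; apply: ler_sum => H HS.
  have wge0 := subset_weight_ge0 _ _ (slots d n) q H q01.
  case: ifP => [EH|_]; last by apply: sumr_ge0.
  have [U EU UH] := sub_projected_cover_hits _ _ _ mn _ E_edges _ EH.
  rewrite (bigD1 U) ?EU ?HS ?UH //= lerDl.
  by apply: sumr_ge0.
apply: ler_sum => U EU; rewrite hyperPr_cover_hits; apply: ler_prod => u uU.
rewrite hit_prob_ge0 //= -/(trace_sum d p #|Defs.span E| #|u| n).
by rewrite -(sum_trace_slots _ _ EU uU) hit_prob_le.
Qed.

Lemma Pr_sub_projected_ge_cover U : is_cover E U ->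
  \prod_(u in U) (1 + trace_sum d p #|Defs.span E| #|u| n)^-1 *
    cover_prod d p E U n <= Pr_sub_projected d p E n.
Proof.
move=> EU; apply: (@le_trans _ _ (hyperPr d (p n) (cover_hits k m n E U))).
  rewrite hyperPr_cover_hits -big_split /=; apply: ler_prod => u uU.
  rewrite -/(trace_sum d p #|Defs.span E| #|u| n) mulr_ge0 ?trace_sum_ge0 //=; last first.
    by rewrite invr_ge0 addr_ge0 ?trace_sum_ge0.
  by rewrite -(sum_trace_slots _ _ EU uU) hit_prob_ge.
rewrite /Pr_sub_projected /hyperPr big_mkcondr [leRHS]big_mkcondr /=.
apply: ler_sum => H _.
have wge0 := subset_weight_ge0 _ _ (slots d n) q H q01.
case: ifP => [UH|_]; last by case: ifP.
by rewrite (cover_hits_sub_projected _ _ _ mn _ E_edges _ _ EU UH).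
Qed.

End Bounds.

(** * Asymptotic exponents *)

Section PowerGrowth.
Local Open Scope classical_set_scope.
Variable R : realType.
Implicit Types (u v w : nat -> R) (a b c : R).

Lemma powR_nat_ge_near c e : 0 < e -> \forall n \near \oo, c <= n%:R `^ e.
Proof.
move=> e0.
near=> n; apply: (le_trans (ler_norm c)).
(* Monotonicity of the power then reduces the claim to [n] being at least a constant. *)
have -> : `|c| = (`|c| `^ e^-1) `^ e by rewrite -powRrM mulVf ?gt_eqF // powRr1.
apply: ge0_ler_powR; rewrite ?nnegrE ?powR_ge0 ?ler0n ?(ltW e0) //.
by near: n; exact: nbhs_infty_ger.
Unshelve. all: by end_near. Qed.

(** Two-sided bounds for every [e] are easier to combine than error sequences; sums, products and
    squeezes all go through this form. *)
Lemma npow_o1P u a : npow_o1 u a <->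
  forall e, 0 < e ->
    \forall n \near \oo, n%:R `^ (a - e) <= u n <= n%:R `^ (a + e).
Proof.
split=> [[eps eps0 ueps] e e0|ua].
  near=> n.
  have n1 : 1 <= n%:R :> R by rewrite ler1n; near: n; exists 1%N.
  have : `|eps n| <= e by near: n; move/cvgr0Pnorm_le: eps0; apply.
  have -> : u n = n%:R `^ (a + eps n) by near: n.
  by rewrite ler_norml => /andP[le1 le2]; rewrite !ler_powR //; lra.
exists (fun n => ln (u n) / ln n%:R - a); last first.
  near=> n.
  have n1 : 1 < n%:R :> R by rewrite ltr1n; near: n; exists 2%N.
  have n0 : 0 < n%:R :> R by lra.
  have /andP[un _] : n%:R `^ (a - 1) <= u n <= n%:R `^ (a + 1).
    by near: n; apply: ua.
  have u0 : 0 < u n by apply: lt_le_trans un; rewrite powR_gt0.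
  rewrite addrC subrK /powR gt_eqF // divfK ?lnK //.
  by rewrite gt_eqF // ln_gt0.
apply/cvgr0Pnorm_le => e e0; near=> n.
have n1 : 1 < n%:R :> R by rewrite ltr1n; near: n; exists 2%N.
have n0 : 0 < n%:R :> R by lra.
have ln0 : 0 < ln n%:R :> R by rewrite ln_gt0.
have /andP[un1 un2] : n%:R `^ (a - e) <= u n <= n%:R `^ (a + e).
  by near: n; apply: ua.
have u0 : 0 < u n by apply: lt_le_trans un1; rewrite powR_gt0.
have lnu1 : a - e <= ln (u n) / ln n%:R.
  by rewrite ler_pdivlMr // -ln_powR ler_ln ?posrE ?powR_gt0.
have lnu2 : ln (u n) / ln n%:R <= a + e.
  by rewrite ler_pdivrMr // -ln_powR ler_ln ?posrE ?powR_gt0.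
by rewrite ler_norml; apply/andP; split; lra.
Unshelve. all: by end_near. Qed.

Lemma npow_o1_squeeze u v w a : npow_o1 v a -> npow_o1 w a ->
  (\forall n \near \oo, v n <= u n <= w n) -> npow_o1 u a.
Proof.
move=> /npow_o1P va /npow_o1P wa uvw; apply/npow_o1P => e e0.
near=> n.
have /andP[vn _] : n%:R `^ (a - e) <= v n <= n%:R `^ (a + e).
  by near: n; apply: va.
have /andP[_ wn] : n%:R `^ (a - e) <= w n <= n%:R `^ (a + e).
  by near: n; apply: wa.
have /andP[vu uw] : v n <= u n <= w n by near: n.
by rewrite (le_trans vn) // (le_trans uw).
Unshelve. all: by end_near. Qed.

Lemma npow_o1_near_eq u v a : (\forall n \near \oo, u n = v n) ->
  npow_o1 u a -> npow_o1 v a.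
Proof.
move=> uv ua; apply: (npow_o1_squeeze v u u a ua ua).
by apply: filterS uv => n ->; rewrite lexx.
Qed.

Lemma npow_o1_powR a : npow_o1 (fun n => n%:R `^ a) a.
Proof.
exists (fun=> 0); first exact: cvg_cst.
by near=> n; rewrite addr0.
Unshelve. all: by end_near. Qed.

Lemma npow_o1_cst c : 0 < c -> npow_o1 (fun=> c) 0.
Proof.
move=> c0; apply/npow_o1P => e e0; rewrite sub0r add0r; near=> n.
apply/andP; split; last by near: n; exact: powR_nat_ge_near.
rewrite powRN -[leRHS]invrK lef_pV2 ?posrE ?invr_gt0 //.
  by near: n; exact: powR_nat_ge_near.
by rewrite powR_gt0 // ltr0n; near: n; exists 1%N.
Unshelve. all: by end_near. Qed.

Lemma npow_o1M u v a b : npow_o1 u a -> npow_o1 v b ->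
  npow_o1 (fun n => u n * v n) (a + b).
Proof.
move=> /npow_o1P ua /npow_o1P vb; apply/npow_o1P => e e0.
have e20 : 0 < e / 2 by rewrite divr_gt0.
near=> n.
have n0 : n%:R != 0 :> R by rewrite pnatr_eq0 -lt0n; near: n; exists 1%N.
have /andP[u1 u2] : n%:R `^ (a - e / 2) <= u n <= n%:R `^ (a + e / 2).
  by near: n; apply: ua.
have /andP[v1 v2] : n%:R `^ (b - e / 2) <= v n <= n%:R `^ (b + e / 2).
  by near: n; apply: vb.
have -> : a + b - e = (a - e / 2) + (b - e / 2) by lra.
have -> : a + b + e = (a + e / 2) + (b + e / 2) by lra.
rewrite (@powRD _ _ (a - _)) ?(@powRD _ _ (a + _)) ?n0 ?implybT //.
have u0 := le_trans (powR_ge0 _ _) u1; have v0 := le_trans (powR_ge0 _ _) v1.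
by rewrite !ler_pM // ?powR_ge0.
Unshelve. all: by end_near. Qed.

Lemma npow_o1D_le u v a b : a <= b -> npow_o1 u a -> npow_o1 v b ->
  npow_o1 (fun n => u n + v n) b.
Proof.
move=> ab /npow_o1P ua /npow_o1P vb; apply/npow_o1P => e e0.
have e20 : 0 < e / 2 by rewrite divr_gt0.
near=> n.
have n1 : 1 <= n%:R :> R by rewrite ler1n; near: n; exists 1%N.
have n0 : n%:R != 0 :> R by rewrite gt_eqF // (lt_le_trans ltr01).
have /andP[u1 u2] : n%:R `^ (a - e / 2) <= u n <= n%:R `^ (a + e / 2).
  by near: n; apply: ua.
have /andP[v1 v2] : n%:R `^ (b - e / 2) <= v n <= n%:R `^ (b + e / 2).
  by near: n; apply: vb.
have u0 := le_trans (powR_ge0 _ _) u1.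
have v3 : n%:R `^ (b - e) <= n%:R `^ (b - e / 2) :> R by rewrite ler_powR //; lra.
have u3 : n%:R `^ (a + e / 2) <= n%:R `^ (b + e / 2) :> R.
  by rewrite ler_powR //; lra.
(* The sum is at most twice the larger bound, and half of the margin [e] absorbs this 2. The lower
   bound comes from [v] alone, as [u n] is nonnegative. *)
have two : 2 <= n%:R `^ (e / 2) :> R by near: n; exact: powR_nat_ge_near.
have -> : b + e = (b + e / 2) + e / 2 by lra.
rewrite [n%:R `^ (_ + e / 2 + e / 2)]powRD ?n0 ?implybT //.
have := powR_ge0 (n%:R : R) (b + e / 2).
by move=> ?; apply/andP; split; nra.
Unshelve. all: by end_near. Qed.

Lemma npow_o1D u v a b : npow_o1 u a -> npow_o1 v b ->
  npow_o1 (fun n => u n + v n) (Num.max a b).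
Proof.
move=> ua vb; case: leP => ab; first exact: npow_o1D_le ua vb.
apply: (npow_o1_near_eq (fun n => v n + u n)).
  by near=> n; rewrite addrC.
exact: (npow_o1D_le _ _ _ _ (ltW ab) vb ua).
Unshelve. all: by end_near. Qed.

Lemma npow_o1_lt0_cvg u a : a < 0 -> npow_o1 u a -> (u @ \oo --> (0 : R))%classic.
Proof.
move=> a0 /npow_o1P ua; apply/cvgr0Pnorm_le => e e0.
(* The margin [- a / 2] leaves the upper exponent [a / 2], which is still negative. *)
have a20 : 0 < - a / 2 by rewrite divr_gt0 ?oppr_gt0.
near=> n.
have /andP[u1 u2] : n%:R `^ (a - - a / 2) <= u n <= n%:R `^ (a + - a / 2).
  by near: n; apply: ua.
rewrite ger0_norm; last exact: le_trans (powR_ge0 _ _) u1.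
apply: (le_trans u2); have -> : a + - a / 2 = - (- a / 2) by lra.
rewrite powRN -[leRHS]invrK lef_pV2 ?posrE ?invr_gt0 //.
  by near: n; exact: powR_nat_ge_near.
by rewrite powR_gt0 // ltr0n; near: n; exists 1%N.
Unshelve. all: by end_near. Qed.

Lemma npow_o1_bin (s j : nat) : npow_o1 (fun n => 'C(n - s, j)%:R : R) j%:R.
Proof.
have K0 : 0 < (2 ^ j * j`!)%:R :> R by rewrite ltr0n muln_gt0 expn_gt0 fact_gt0.
apply: (npow_o1_squeeze _ (fun n => ((2 ^ j * j`!)%:R)^-1 * n%:R `^ j%:R)
  (fun n => n%:R `^ j%:R)).
- rewrite -[X in npow_o1 _ X]add0r; apply: npow_o1M (npow_o1_powR _).
  by apply: npow_o1_cst; rewrite invr_gt0.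
- exact: npow_o1_powR.
near=> n.
(* From here on every factor [n - s - i] with [i < j] of the falling factorial lies between [n / 2]
   and [n]. *)
have ns : (2 * (s + j) <= n)%N by near: n; exists (2 * (s + j))%N.
rewrite powR_mulrn ?ler0n // ler_pdivrMl // -natrX -natrM !ler_nat.
rewrite -mulnA [(j`! * _)%N]mulnC bin_ffact ffact_prod.
have prodE (x : nat) : \prod_(i < j) x = (x ^ j)%N :> nat.
  by rewrite prod_nat_const card_ord.
apply/andP; split.
  rewrite -!prodE -big_split /=; apply: leq_prod => i _.
  by have := ltn_ord i; lia.
apply: (@leq_trans ('C(n - s, j) * j`!)%N); first by rewrite leq_pmulr ?fact_gt0.
rewrite bin_ffact ffact_prod -prodE; apply: leq_prod => i _; lia.
Unshelve. all: by end_near. Qed.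

(* Exponent [-oo] encodes a sequence that vanishes eventually, so that sums and
   products of sequences correspond to [maxe] and [+] of exponents. *)
Definition npowe (u : nat -> R) (x : \bar R) : Prop :=
  match x with
  | EFin a => npow_o1 u a
  | EPInf => False
  | ENInf => \forall n \near \oo, u n = 0
  end.

Lemma npoweM u v (x y : \bar R) : npowe u x -> npowe v y ->
  npowe (fun n => u n * v n) (x + y)%E.
Proof.
case: x => [a||] //= ux; case: y => [b||] //= vy; first exact: npow_o1M.
- by apply: filterS vy => n ->; rewrite mulr0.
- by apply: filterS ux => n ->; rewrite mul0r.
- by apply: filterS ux => n ->; rewrite mul0r.
Qed.

Lemma npoweD u v (x y : \bar R) : npowe u x -> npowe v y ->
  npowe (fun n => u n + v n) (maxe x y).
Proof.
case: x => [a|[]|] ux; case: y => [b|[]|] vy.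
- by rewrite -EFin_max; exact: npow_o1D.
- rewrite maxeNy /=; apply: npow_o1_near_eq ux.
  by apply: filterS vy => n ->; rewrite addr0.
- rewrite maxNye /=; apply: npow_o1_near_eq vy.
  by apply: filterS ux => n ->; rewrite add0r.
- rewrite maxNye; apply: filterS2 ux vy => n -> ->; exact: addr0.
Qed.

Lemma npowe_lt0_cvg u (x : \bar R) : (x < 0)%E -> npowe u x ->
  (u @ \oo --> (0 : R))%classic.
Proof.
case: x => [a||] //=; first by rewrite lte_fin; exact: npow_o1_lt0_cvg.
move=> _ u0; apply/cvgr0Pnorm_le => e e0.
by apply: filterS u0 => n ->; rewrite normr0 ltW.
Qed.

Lemma npowe_sum (I : Type) (r : seq I) (P : pred I) (u : I -> nat -> R)
    (x : I -> \bar R) : (forall i, P i -> npowe (u i) (x i)) ->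
  npowe (fun n => \sum_(i <- r | P i) u i n)
    (\big[maxe/-oo%E]_(i <- r | P i) x i)%E.
Proof.
move=> ux; elim: r => [|i r IHr].
  by rewrite big_nil /=; near=> n; rewrite big_nil.
rewrite big_cons; under eq_fun do rewrite big_cons.
by case: ifP => // Pi; apply: npoweD => //; exact: ux.
Unshelve. all: by end_near. Qed.

Lemma npowe_prod (I : Type) (r : seq I) (P : pred I) (u : I -> nat -> R)
    (x : I -> \bar R) : (forall i, P i -> npowe (u i) (x i)) ->
  npowe (fun n => \prod_(i <- r | P i) u i n) (\sum_(i <- r | P i) x i)%E.
Proof.
move=> ux; elim: r => [|i r IHr].
  by rewrite big_nil /=; under eq_fun do rewrite big_nil; exact: npow_o1_cst.
rewrite big_cons; under eq_fun do rewrite big_cons.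
by case: ifP => // Pi; apply: npoweM => //; exact: ux.
Qed.

End PowerGrowth.

(** * Exponents of trace sums and cover products *)

Section Exponents.
Variables (R : realType) (k : nat) (d : 'I_k -> nat) (delta : 'I_k -> R).
Variable p : nat -> 'I_k -> R.
Hypothesis delta01 : forall i : 'I_k, 0 < delta i < 1.
Hypothesis p_npow : forall i : 'I_k,
  npow_o1 (fun n : nat => p n i) (1 - (d i)%:R + delta i).

(** In the term of index [i] the binomial has exponent [d i - l] and the probability
    [1 - d i + delta i], in total [1 + delta i - l]; the largest one wins. If no [d i] reaches [l],
    the sum is empty and both sides degenerate to [-oo]. *)
Lemma trace_sum_npowe (s l : nat) :
  npowe R (trace_sum d p s l) (1 + max_delta d delta l - (l%:R)%:E)%E.
Proof.
have -> : (1 + max_delta d delta l - (l%:R)%:E =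
    \big[maxe/-oo]_(i < k | (l <= d i)%N) (1 + delta i - l%:R)%:E)%E.
  rewrite (big_morph (fun x => 1 + x - (l%:R)%:E)%E (op1 := maxe) (id1 := -oo%E)) //.
  by move=> x y; rewrite adde_maxr adde_maxl.
apply: npowe_sum => i ldi /=.
have -> : 1 + delta i - l%:R = (d i - l)%:R + (1 - (d i)%:R + delta i) :> R.
  by rewrite natrB //; lra.
by apply: npow_o1M => //; exact: npow_o1_bin.
Qed.

Lemma cover_prod_npowe m (E U : {set {set 'I_m}}) :
  npowe R (cover_prod d p E U)
    (\sum_(u in U) (1 + max_delta d delta #|u| - (#|u|%:R)%:E))%E.
Proof. by apply: npowe_prod => u _; exact: trace_sum_npowe. Qed.

Lemma max_delta_lt1 l : (max_delta d delta l < 1)%E.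
Proof.
apply: (big_ind (fun x => x < 1)%E) => [|x y x1 y1|i _]; first exact: ltNyr.
- by rewrite gt_max x1.
- by rewrite lte_fin; have /andP[] := delta01 i.
Qed.

(** The exponent is negative: it is below [2 - l], because every [delta i] is below 1. *)
Lemma trace_sum_cvg0 s l : (2 <= l)%N ->
  (trace_sum d p s l @ \oo --> (0 : R))%classic.
Proof.
move=> l2; apply: (npowe_lt0_cvg _ _ _ _ (trace_sum_npowe s l)).
have := max_delta_lt1 l; case: (max_delta d delta l) => [x||] //=; last first.
  by rewrite addeNy addNye ltNyr.
rewrite !lte_fin => x1.
have : 2 <= l%:R :> R by rewrite ler_nat.
by move: x1; lra.
Qed.

Lemma prod_trace_sum_cvg1 m (E U : {set {set 'I_m}}) : is_cover E U ->
  ((fun n => \prod_(u in U) (1 + trace_sum d p #|Defs.span E| #|u| n)^-1)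
     @ \oo --> (1 : R))%classic.
Proof.
case/and3P => _ /forall_inP U2 _.
have := @cvg_big R _ _ 1 (mem U) (@mul_continuous R) _ \oo%classic (index_enum _)
  (fun u n => (1 + trace_sum d p #|Defs.span E| #|u| n)^-1) (fun=> 1) _.
rewrite big1_eq; apply=> u /U2/andP[u2 _].
rewrite -[X in (_ --> X)%classic]invr1.
apply: (@cvgV R nat \oo%classic _ (fun n => 1 + _)); first exact: oner_neq0.
rewrite -[X in (_ --> X)%classic]addr0.
apply: (@cvgD R R^o nat \oo%classic _ (fun=> 1)); first exact: cvg_cst.
exact: trace_sum_cvg0.
Qed.

Lemma max_delta_gtNy l : (exists i, (l <= d i)%N) -> (-oo < max_delta d delta l)%E.
Proof.
case=> i ldi; apply: (@lt_le_trans _ _ (delta i)%:E); first exact: ltNyr.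
exact: le_bigmax_cond.
Qed.

End Exponents.

(** No pair contains another one, so each edge is needed for its own coverage. This provides a cover
    to maximise over. *)
Lemma is_cover_self (T : finType) (E : {set {set T}}) :
  (forall e, e \in E -> #|e| = 2%N) -> is_cover E E.
Proof.
move=> E2.
have pairsE e : e \in E -> e \in pairs e by move=> eE; rewrite inE subxx E2.
apply/and3P; split.
- by apply/fintype.subsetP => e eE; rewrite powersetE finset.bigcup_sup.
- apply/forall_inP => e eE; rewrite E2 //=; apply/subsetPn; exists e => //.
  apply/bigcupP => -[e']; rewrite !inE => /andP[ne' e'E] /andP[ee' _].
  by move: ne'; rewrite eq_sym eqEcard ee' !E2.
- by apply/fintype.subsetP => e eE; apply/bigcupP; exists e => //; exact: pairsE.
Qed.

Theorem theorem2 (R : realType) (k : nat) (d : 'I_k -> nat)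
    (delta : 'I_k -> R) (p : nat -> 'I_k -> R)
    (m : nat) (E : {set {set 'I_m}})
    (k_ge1 : (1 <= k)%N)
    (d_ge2 : forall i : 'I_k, (2 <= d i)%N)
    (d_incr : forall i j : 'I_k, (i < j)%N -> (d i < d j)%N)
    (delta01 : forall i : 'I_k, 0 < delta i < 1)
    (p01 : forall (n : nat) (i : 'I_k), 0 <= p n i <= 1)
    (p_npow : forall i : 'I_k,
       npow_o1 (fun n : nat => p n i) (1 - (d i)%:R + delta i))
    (E_neq0 : E != finset.set0)
    (E_edges : forall e : {set 'I_m}, e \in E -> #|e| = 2%N) :
  [/\ exists2 a : R, cover_exponent E (max_delta d delta) = a%:E &
        npow_o1 (Pr_sub_projected d p E) a,
      forall U : {set {set 'I_m}}, is_cover E U ->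
        exists2 eta : nat -> R, (eta @ \oo --> (0 : R))%classic &
          (\forall n \near \oo,
             (1 - eta n) * cover_prod d p E U n <= Pr_sub_projected d p E n)%classic
    & forall n : nat, (m <= n)%N ->
        Pr_sub_projected d p E n <=
          \sum_(U : {set {set 'I_m}} | is_cover E U) cover_prod d p E U n].
Proof.
have upper n : (m <= n)%N -> Pr_sub_projected d p E n <=
    \sum_(U : {set {set 'I_m}} | is_cover E U) cover_prod d p E U n.
  by move=> mn; exact: Pr_sub_projected_le_sum_cover.
have lower (U : {set {set 'I_m}}) : is_cover E U ->
    exists2 eta : nat -> R, (eta @ \oo --> (0 : R))%classic &
      (\forall n \near \oo,
        (1 - eta n) * cover_prod d p E U n <= Pr_sub_projected d p E n)%classic.
  move=> EU.
  (* The error is what the loss factors of the single-cover bound lack to 1. *)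
  exists (fun n => 1 - \prod_(u in U) (1 + trace_sum d p #|Defs.span E| #|u| n)^-1).
    rewrite -[X in (_ --> X)%classic](subrr 1); apply: cvgB; first exact: cvg_cst.
    exact: (prod_trace_sum_cvg1 _ _ _ delta).
  exists m => // n mn; rewrite opprB addrC subrK.
  exact: Pr_sub_projected_ge_cover.
split=> //.
pose total n := \sum_(U : {set {set 'I_m}} | is_cover E U) cover_prod d p E U n.
have totalE : npowe R total (cover_exponent E (max_delta d delta)).
  by apply: npowe_sum => U _; exact: cover_prod_npowe.
have : (-oo < cover_exponent E (max_delta d delta))%E.
  apply: lt_le_trans (le_bigmax_cond _ _ (is_cover_self _ _ E_edges)).
  apply: (big_ind (fun x => -oo < x)%E) => [|x y|e eE]; first exact: ltNyr.
    by case: x => [x||]; case: y => [y||] //= _ _; rewrite ?ltNyr.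
  have : (-oo < max_delta d delta #|e|)%E.
    (* Edges have size 2 and every degree is at least 2, so any index works; [k_ge1] provides
       one. *)
    by apply: max_delta_gtNy; exists (Ordinal k_ge1); rewrite E_edges.
  by case: (max_delta d delta #|e|) => [x||] //= _; rewrite ltNyr.
case: (cover_exponent E (max_delta d delta)) totalE => [a||] //= totala _.
exists a => //.
pose N := #|{set {set 'I_m}}|%:R : R.
have N0 : 0 < N by rewrite ltr0n; apply/card_gt0P; exists finset.set0.
(* There are at most [N] covers, and eventually each has product at most twice the probability, so
   the upper bound is sharp up to the factor [2 * N]. *)
apply: (npow_o1_squeeze _ _ (fun n => (2 * N)^-1 * total n) total) => //.
  rewrite -[a]add0r; apply: npow_o1M totala; apply: npow_o1_cst.
  by rewrite invr_gt0 mulr_gt0.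
have half : (\forall n \near \oo, forall U : {set {set 'I_m}}, is_cover E U ->
    cover_prod d p E U n <= 2 * Pr_sub_projected d p E n)%classic.
  (* Finitely many covers, so one threshold on [n] serves all; the 2 comes from [eta n <= 2^-1]. *)
  apply: filter_forall => U.
  have [EU|] := boolP (is_cover E U); last by move=> _; exact: nearW.
  have [eta /cvgr0Pnorm_le eta0 low] := lower U EU.
  have := eta0 2^-1; rewrite invr_gt0 ltr0n => /(_ isT) eta2.
  apply: filterS2 eta2 low => n; rewrite ler_norml => /andP[_ e2] low _.
  have c0 : 0 <= cover_prod d p E U n.
    by apply: prodr_ge0 => u _; exact: trace_sum_ge0.
  by nra.
near=> n; have mn : (m <= n)%N by near: n; exists m.
rewrite upper // andbT ler_pdivrMl ?mulr_gt0 //.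
have halfn : forall U : {set {set 'I_m}}, is_cover E U ->
    cover_prod d p E U n <= 2 * Pr_sub_projected d p E n by near: n.
have Pr0 : 0 <= Pr_sub_projected d p E n.
  apply: sumr_ge0 => H _; apply: (subset_weight_ge0 _ _ _ (fun x => p n x.1)).
  by move=> x; exact: p01.
apply: (@le_trans _ _ (\sum_(U : {set {set 'I_m}}) 2 * Pr_sub_projected d p E n)).
  rewrite /total big_mkcond; apply: ler_sum => U _.
  by case: ifP => [/halfn //|_]; rewrite mulr_ge0.
by rewrite sumr_const -[leLHS]mulr_natl mulrA [_ * 2]mulrC.
Unshelve. all: by end_near. Qed.
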